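(* Let $n\ge1$ and let $K=\{i_1,\dots,i_{n+1}\}\subset V_{2n}$ be a subset with $n+1$ elements having property $(\ast)$. Then in $\mathbb{Z}[\mathcal{GQ}_{2n}]/\mathcal{J}$ the following formula holds: $$\Delta_{K}=\Delta_{\{i_{1},\ldots,i_{n-1},\overline{i_{n}},\overline{i_{n+1}}\}}.$$
   Context: **The ring $\mathbb{Z}[\mathcal{GQ}_{2n}]$.** Let $V_{2n}=[2n+2]=\{1,\dots,2n+2\}$ and $\overline{i}=2n+3-i$ for $i\in V_{2n}$. A non-empty subset $K\subset V_{2n}$ has property $(\ast)$ if $\{i,\overline{i}\}\not\subset K$ for all $i\in V_{2n}$. Let $\mathbb{Z}[\mathcal{M},\mathcal{D}]$ be the polynomial ring over $\mathbb{Z}$ on variables $M_v$ ($v\in V_{2n}$), of degree $2$, and $\Delta_K$ ($K\subset V_{2n}$ non-empty with property $(\ast)$), of degree $4n-2|K|+2$. For $J\subset V_{2n}$ put $G_J=M_v$ if $J=V_{2n}\setminus\{v\}$, and $G_J=\Delta_J$ if $J$ is non-empty with property $(\ast)$. Let $\mathcal{I}$ be the ideal generated by: (1) all products $G_{J_1}\cdots G_{J_r}$ ($r\ge1$, each $J_s$ of one of the two kinds just described) with $J_1\cap\cdots\cap J_r=\emptyset$; (2) $(M_i+M_{\overline{i}})-(M_j+M_{\overline{j}})$ for all distinct $i,j\in V_{2n}$; (3) $\prod_{i\in I}M_i-(\Delta_{(I\cup\{a\})^c}+\Delta_{(I\cup\{\overline{a}\})^c})$ for all $I\subset V_{2n}$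 with property $(\ast)$ and $|I|=n$, where $\{a,\overline{a}\}$ is the unique such pair contained in $V_{2n}\setminus I$ and $(\cdot)^c$ is the complement in $V_{2n}$; (4) $\Delta_K\cdot M_i-\Delta_{K\setminus\{i\}}$ for all $K$ with property $(\ast)$ and $\{i\}\subsetneq K$. Then $\mathbb{Z}[\mathcal{GQ}_{2n}]:=\mathbb{Z}[\mathcal{M},\mathcal{D}]/\mathcal{I}$, and $\mathcal{J}$ is the ideal of $\mathbb{Z}[\mathcal{GQ}_{2n}]$ generated by $M_{i+1}-M_1$ for $i=1,\dots,n+1$. *)

(* Defs.v *)
From HB Require Import structures.
From mathcomp Require Import all_boot all_order all_algebra.
From mathcomp Require Import boolp.
From mathcomp Require Import mpoly.

Set Implicit Arguments.
Unset Strict Implicit.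
Unset Printing Implicit Defensive.

Import GRing.Theory.
Local Open Scope ring_scope.
Local Open Scope quotient_scope.

Section GeneratedIdeal.
Variables (R : comPzRingType) (X : R -> Prop).

Definition gen_ideal : {pred R} := fun x =>
  `[< exists s : seq (R * R),
        (forall p, p \in s -> X p.2) /\ x = \sum_(p <- s) p.1 * p.2 >].

Lemma gen_idealP x :
  reflect (exists s : seq (R * R),
             (forall p, p \in s -> X p.2) /\ x = \sum_(p <- s) p.1 * p.2)
          (x \in gen_ideal).
Proof. exact: asboolP. Qed.

Lemma mem_gen_ideal x : X x -> x \in gen_ideal.
Proof.
move=> Xx; apply/gen_idealP; exists [:: (1, x)]; split.
  by move=> p; rewrite inE => /eqP ->.
by rewrite big_seq1 /= mul1r.
Qed.

Lemma gen_idealMl a x : x \in gen_ideal -> a * x \in gen_ideal.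
Proof.
case/gen_idealP => s [sX ->]; apply/gen_idealP.
exists [seq (a * p.1, p.2) | p <- s]; split.
  by move=> _ /mapP[p /sX Xp ->].
by rewrite big_map mulr_sumr; apply: eq_bigr => p _ /=; rewrite mulrA.
Qed.

Lemma gen_ideal_zmod_closed : zmod_closed gen_ideal.
Proof.
have idealD x y : x \in gen_ideal -> y \in gen_ideal -> x + y \in gen_ideal.
  case/gen_idealP=> s [sX ->] /gen_idealP[t [tX ->]].
  apply/gen_idealP; exists (s ++ t); split; last by rewrite big_cat.
  by move=> p; rewrite mem_cat => /orP[/sX|/tX].
split=> [|x y xI yI].
  by apply/gen_idealP; exists [::]; split; rewrite ?big_nil.
by apply: idealD => //; rewrite -mulN1r; apply: gen_idealMl.
Qed.

HB.instance Definition _ :=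
  GRing.isZmodClosed.Build R gen_ideal gen_ideal_zmod_closed.

(* Unlike {ideal_quot _}, this makes no properness assumption on the ideal,
   whence a comPzRingType. *)
Definition quot_ring : Type := Quotient.quot gen_ideal.

HB.instance Definition _ := GRing.Zmodule.on quot_ring.

Definition qclass (x : R) : quot_ring := \pi_(Quotient.quot gen_ideal) x.

Lemma qclassE x y : (qclass x = qclass y) <-> (x - y \in gen_ideal).
Proof. by rewrite Quotient.idealrBE; split=> /eqP. Qed.

Lemma qclass_surj (u : quot_ring) : exists x, qclass x = u.
Proof. by exists (repr (u : Quotient.quot gen_ideal)); apply: reprK. Qed.

Fact qclassD : {morph qclass : x y / x + y}.
Proof. exact: Quotient.pi_add. Qed.

Fact qclassN : {morph qclass : x / - x}.
Proof. exact: Quotient.pi_opp. Qed.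

Definition qone : quot_ring := qclass 1.
Definition qmul (u v : quot_ring) : quot_ring :=
  qclass (repr (u : Quotient.quot gen_ideal)
            * repr (v : Quotient.quot gen_ideal)).

Fact qclassM x y : qclass (x * y) = qmul (qclass x) (qclass y).
Proof.
have reprP z : z - repr (qclass z : Quotient.quot gen_ideal) \in gen_ideal.
  by apply/qclassE; rewrite /qclass reprK.
move: (reprP x) (reprP y); rewrite /qmul.
set x' := repr _; set y' := repr _ => hx hy; apply/qclassE.
have -> : x * y - x' * y' = y * (x - x') + x' * (y - y').
  by rewrite !mulrBr [y * x]mulrC [y * x']mulrC addrA subrK.
by rewrite rpredD // gen_idealMl.
Qed.

Fact qmulA : associative qmul.
Proof.
move=> u v w.
case: (qclass_surj u) (qclass_surj v) (qclass_surj w) => x <- [y <-] [z <-].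
by rewrite -!qclassM mulrA.
Qed.

Fact qmulC : commutative qmul.
Proof.
move=> u v; case: (qclass_surj u) (qclass_surj v) => x <- [y <-].
by rewrite -!qclassM mulrC.
Qed.

Fact qmul1 : left_id qone qmul.
Proof. by move=> u; case: (qclass_surj u) => x <-; rewrite -qclassM mul1r. Qed.

Fact qmulDl : left_distributive qmul +%R.
Proof.
move=> u v w.
case: (qclass_surj u) (qclass_surj v) (qclass_surj w) => x <- [y <-] [z <-].
by rewrite -qclassD -!qclassM mulrDl qclassD.
Qed.

HB.instance Definition _ :=
  GRing.Zmodule_isComPzRing.Build quot_ring qmulA qmulC qmul1 qmulDl.

Fact qclass_is_zmod_morphism : zmod_morphism qclass.
Proof. by move=> x y; rewrite qclassD qclassN. Qed.

Fact qclass_is_monoid_morphism : monoid_morphism qclass.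
Proof. by split=> // x y; rewrite qclassM. Qed.

HB.instance Definition _ :=
  GRing.isZmodMorphism.Build R quot_ring qclass qclass_is_zmod_morphism.
HB.instance Definition _ :=
  GRing.isMonoidMorphism.Build R quot_ring qclass qclass_is_monoid_morphism.

End GeneratedIdeal.

(* V n is {1, ..., 2n+2} shifted to {0, ..., 2n+1}: the integer i is the ordinal
   of value i - 1, so that i |-> 2n+3-i becomes rev_ord. *)
Definition V (n : nat) : finType := 'I_(n.*2.+2).
Definition bar (n : nat) (i : V n) : V n := rev_ord i.

Definition star (n : nat) (K : {set V n}) : bool :=
  (K != set0) && [forall i : V n, ~~ ([set i; bar i] \subset K)].

Lemma barK (n : nat) : involutive (@bar n).
Proof. exact: rev_ordK. Qed.

Lemma starP (n : nat) (K : {set V n}) :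
  reflect (K != set0 /\ forall i, i \in K -> bar i \notin K) (star K).
Proof.
apply: (iffP andP) => -[K0 h]; split=> //.
  move=> i iK; apply/negP => biK; move/forallP/(_ i): h.
  by rewrite subUset !sub1set iK biK.
apply/forallP => i; rewrite subUset !sub1set; apply/negP => /andP[iK].
exact/negP/h.
Qed.

Lemma bar_neq (n : nat) (i : V n) : bar i != i.
Proof.
apply/eqP => /(congr1 (fun x : 'I__ => odd (x + i))) /=.
have le_in : (i.+1 <= n.*2.+2)%N := ltn_ord i.
by rewrite subSS subnK // addnn odd_double /= odd_double.
Qed.

Lemma star_compl (n : nat) (I : {set V n}) (a : V n) :
  star I -> #|I| = n -> [set a; bar a] \subset ~: I ->
  star (~: (I :|: [set a])) /\ star (~: (I :|: [set bar a])).
Proof.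
move=> /starP[_ hI] cI; rewrite subUset !sub1set !inE => /andP[aI baI].
pose B := I :|: [set bar i | i in I].
have cB : #|B| = n.*2.
  rewrite cardsU card_imset ?cI; last exact: (can_inj (@barK n)).
  rewrite (_ : I :&: _ = set0) ?cards0 ?subn0 ?addnn //.
  apply/setP => x; rewrite !inE; apply/negP => /andP[xI /imsetP[y yI xE]].
  by move: (hI y yI); rewrite -xE xI.
have BE x : (x \in B) = (x \in I) || (bar x \in I).
  rewrite !inE; congr (_ || _); apply/imsetP/idP => [[y yI ->]|bx].
    by rewrite barK.
  by exists (bar x); rewrite ?barK.
have cover x : [|| x \in I, bar x \in I, x == a | x == bar a].
  have : ~: B = [set a; bar a].
    apply/eqP; rewrite eq_sym eqEcard; apply/andP; split.
      by rewrite subUset !sub1set !inE -!in_setU !BE barK negb_or aI baI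
        negb_or aI baI.
    rewrite cardsCs setCK cB cards2 eq_sym bar_neq.
    by rewrite card_ord -addn2 addnC addnK.
  move/setP/(_ x); rewrite in_setC BE in_set2.
  by case: (x \in I) => //; case: (bar x \in I) => //= <-.
have aux b : b \notin I -> (b == a) || (b == bar a) -> star (~: (I :|: [set b])).
  move=> bI bE; apply/starP; split.
    apply/set0Pn; exists (bar b); rewrite !inE (negPf (bar_neq _)) orbF.
    by case/orP: bE => /eqP ->; rewrite ?barK.
  move=> x; rewrite !inE !negb_or negb_and !negbK => /andP[xI xb].
  move: (cover x); rewrite (negPf xI) /= => /orP[->//|xE].
  apply/orP; right; move: xb; case/orP: xE => /eqP ->;
    case/orP: bE => /eqP ->; by rewrite ?barK ?eqxx.
by split; apply: aux => //; rewrite eqxx ?orbT.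
Qed.

Lemma star_setD1 (n : nat) (K : {set V n}) (i : V n) :
  star K -> [set i] \proper K -> star (K :\ i).
Proof.
move=> /starP[_ hK] /properP[_ [x xK xi]]; apply/starP; split.
  by apply/set0Pn; exists x; rewrite !inE xK andbT; rewrite inE in xi.
by move=> y; rewrite !inE negb_and => /andP[_ /hK ->]; rewrite orbT.
Qed.

Lemma star_flip (n m : nat) (i : 'I_m -> V n) (p : pred 'I_m) :
  injective i -> star [set i k | k : 'I_m] ->
  star [set (if p k then i k else bar (i k)) | k : 'I_m].
Proof.
move=> inj_i /starP[K0 hK].
have iK k : i k \in [set i k | k : 'I_m] by apply: imset_f.
have nb k l : i k <> bar (i l).
  by move=> kl; move: (hK _ (iK l)); rewrite -kl iK.
apply/starP; split.
  case/set0Pn: K0 => _ /imsetP[k _ _].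
  by apply/set0Pn; exists (if p k then i k else bar (i k)); apply: imset_f.
move=> _ /imsetP[k _ ->]; apply/negP => /imsetP[l _].
case: ifP => pk; case: ifP => pl; rewrite ?barK.
- by move/esym/nb.
- by move/(can_inj (@barK n))/inj_i=> kl; rewrite -kl pk in pl.
- by move/inj_i=> kl; rewrite kl pl in pk.
- by move/nb.
Qed.

(* inl v indexes M_v and inr K indexes Delta_K. *)
Definition var (n : nat) : finType := (V n + {K : {set V n} | star K})%type.

(* The set J such that G_J is the given variable. *)
Definition supp (n : nat) (x : var n) : {set V n} :=
  match x with inl v => ~: [set v] | inr K => val K end.

Definition ZMD (n : nat) : comNzRingType := {mpoly int[#|var n|]}.

Definition G (n : nat) (x : var n) : ZMD n := 'X_(enum_rank x).
Definition M (n : nat) (v : V n) : ZMD n := G (inl v).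

(* Delta K is set to 0 when K does not satisfy star; by star_compl,
   star_setD1 and star_flip the sets used below all have it. *)
Definition Delta (n : nat) (K : {set V n}) : ZMD n :=
  if insub K is Some K' then G (inr K') else 0.

Lemma DeltaE (n : nat) (K : {set V n}) (sK : star K) :
  Delta K = G (inr (Sub K sK)).
Proof. by rewrite /Delta insubT. Qed.

Inductive GQ_rel (n : nat) : ZMD n -> Prop :=
| GQ_rel1 (s : seq (var n)) :
    s != [::] -> \bigcap_(x <- s) supp x = set0 ->
    GQ_rel (\prod_(x <- s) G x)
| GQ_rel2 (i j : V n) :
    i != j -> GQ_rel ((M i + M (bar i)) - (M j + M (bar j)))
| GQ_rel3 (I : {set V n}) (a : V n) :
    star I -> #|I| = n -> [set a; bar a] \subset ~: I ->
    GQ_rel (\prod_(i in I) M i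
              - (Delta (~: (I :|: [set a])) + Delta (~: (I :|: [set bar a]))))
| GQ_rel4 (K : {set V n}) (i : V n) :
    star K -> [set i] \proper K ->
    GQ_rel (Delta K * M i - Delta (K :\ i)).

Definition ZGQ (n : nat) : comPzRingType := quot_ring (@GQ_rel n).

Definition gqM (n : nat) (v : V n) : ZGQ n := qclass (@GQ_rel n) (M v).
Definition gqDelta (n : nat) (K : {set V n}) : ZGQ n :=
  qclass (@GQ_rel n) (Delta K).

(* Generators of J; because of the shift, M_{i+1} is gqM at the ordinal i and
   M_1 is gqM at ord0. *)
Definition J_gen (n : nat) (x : ZGQ n) : Prop :=
  exists i : V n, [/\ (1 <= i)%N, (i <= n.+1)%N & x = gqM i - gqM ord0].

Definition ZGQ_mod_J (n : nat) : comPzRingType := quot_ring (@J_gen n).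

Definition modJ (n : nat) (x : ZGQ n) : ZGQ_mod_J n := qclass (@J_gen n) x.

(* Main.v *)
Require Import Defs.
From mathcomp Require Import all_boot.
From mathcomp Require Import all_algebra.
From mathcomp Require Import zify.

(** Modulo J all the classes M_v coincide: relation (2) for the pair
    {M_(n+1), M_(n+2)} of already identified classes forces every sum
    M_v + M_(bar v) to be twice the common value m.  Relation (3) then says that
    Delta_K plus the Delta of K with one element replaced by its conjugate is
    m^n, whatever K and the element; replacing two elements in turn therefore
    leaves Delta_K unchanged. *)

Import GRing.Theory.
Local Open Scope ring_scope.

Lemma gqM_add_bar (n : nat) (u v : V n) :
  gqM u + gqM (bar u) = gqM v + gqM (bar v).
Proof.
have [->//|uv] := eqVneq u v.
rewrite /gqM -!rmorphD; apply/qclassE.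
exact: mem_gen_ideal (GQ_rel2 uv).
Qed.

Lemma modJD (n : nat) (x y : ZGQ n) : modJ (x + y) = modJ x + modJ y.
Proof. exact: rmorphD. Qed.

Lemma modJ_gqM_le (n : nat) (v : V n) :
  (v <= n.+1)%N -> modJ (gqM v) = modJ (gqM (ord0 : V n)).
Proof.
move=> vn; case: (posnP v) => [v0|v0].
  by congr (modJ (gqM _)); apply: val_inj.
by apply/qclassE; apply: mem_gen_ideal; exists v.
Qed.

Lemma modJ_gqM (n : nat) (v : V n) : modJ (gqM v) = modJ (gqM (ord0 : V n)).
Proof.
have [vn|nv] := leqP v n.+1; first exact: modJ_gqM_le.
(* With indices starting at 0, the ordinals [n] and [n.+1] are conjugate and both at most [n.+1];
   for [v] above [n.+1], [bar v] lies below [n]. *)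
have ltn : (n < n.*2.+2)%N by lia.
have := congr1 (@modJ n) (gqM_add_bar n v (Ordinal ltn)).
rewrite !modJD.
rewrite (modJ_gqM_le n (bar v)); last by rewrite /=; lia.
rewrite (modJ_gqM_le n (Ordinal ltn)) //.
rewrite (modJ_gqM_le n (bar (Ordinal ltn))); last by rewrite /=; lia.
exact: addIr.
Qed.

Definition flip (n : nat) (K : {set V n}) (k : V n) : {set V n} :=
  bar k |: (K :\ k).

(** Lets a second element be replaced after the first, and ensures that [Delta] of the new set is a
    variable and not the default 0. *)
Lemma star_flip1 (n : nat) (K : {set V n}) (k : V n) :
  star K -> k \in K -> star (flip n K k).
Proof.
move=> /starP[_ hK] kK; apply/starP; split.
  by apply/set0Pn; exists (bar k); rewrite !inE eqxx.
move=> x; rewrite !inE !(inj_eq (can_inj (@barK n))) (can2_eq (@barK n) (@barK n)).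
case/orP=> [/eqP ->|/andP[xk xK]]; first by rewrite barK eqxx (negPf (bar_neq k)).
by rewrite (negPf xk) (negPf (hK x xK)) andbF.
Qed.

Lemma card_flip (n : nat) (K : {set V n}) (k : V n) :
  star K -> k \in K -> #|flip n K k| = #|K|.
Proof.
move=> /starP[_ hK] kK; rewrite cardsU1 [RHS](cardsD1 k) kK.
by rewrite !inE (negPf (hK k kK)) andbF.
Qed.

(** [K] is disjoint from its set of conjugates, and the two sets of [n.+1] elements exhaust the
    [n.*2.+2] elements of [V n]. *)
Lemma setC_bar (n : nat) (K : {set V n}) :
  star K -> #|K| = n.+1 -> ~: [set bar x | x in K] = K.
Proof.
move=> /starP[_ hK] cK; apply/esym/eqP; rewrite eqEcard; apply/andP; split.
  apply/subsetP => x xK; rewrite inE; apply/imsetP => -[y yK xE].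
  by move: (hK y yK); rewrite -xE xK.
rewrite cardsCs setCK card_imset; last exact: can_inj (@barK n).
by rewrite card_ord cK; lia.
Qed.

Lemma modJ_Delta_flip (n : nat) (K : {set V n}) (k : V n) :
  (1 <= n)%N -> star K -> #|K| = n.+1 -> k \in K ->
  modJ (gqDelta K) + modJ (gqDelta (flip n K k)) = modJ (gqM (ord0 : V n)) ^+ n.
Proof.
move=> n1 sK cK kK; have /starP[_ hK] := sK.
have inj_bar := can_inj (@barK n).
(* Chosen so that adding [bar k] gives the conjugates of [K], and adding [k] those of [flip n K k];
   the complements in relation (3) are then these two sets. *)
pose I := [set bar x | x in K :\ k].
have KE : ~: (I :|: [set bar k]) = K.
  by rewrite -imset_set1 -imsetU setUC setD1K // setC_bar.
have fKE : ~: (I :|: [set bar (bar k)]) = flip n K k.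
  rewrite -imset_set1 -imsetU setUC setC_bar ?star_flip1 //.
  by rewrite card_flip.
have cI : #|I| = n.
  by rewrite card_imset //; move: cK; rewrite (cardsD1 k) kK => -[].
(* Here [n] must be positive: [star] excludes the empty set. *)
have sI : star I.
  apply/starP; split; first by rewrite -card_gt0 cI.
  move=> _ /imsetP[x /setD1P[_ xK] ->]; rewrite mem_imset // inE.
  by rewrite (negPf (hK x xK)) andbF.
have aI : [set bar k; bar (bar k)] \subset ~: I.
  rewrite subUset !sub1set !inE !mem_imset // !inE eqxx /=.
  by rewrite (negPf (hK k kK)) andbF.
have /mem_gen_ideal/qclassE := @GQ_rel3 n I (bar k) sI cI aI.
rewrite KE fKE rmorphD rmorph_prod => /(congr1 (@modJ n)).
rewrite modJD [LHS]rmorph_prod => <-.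
rewrite (eq_bigr (fun=> modJ (gqM (ord0 : V n)))); last first.
  by move=> v _; exact: modJ_gqM.
by rewrite prodr_const cI.
Qed.

Theorem lemma7p2 (n : nat) (i : 'I_n.+1 -> V n) (K : {set V n})
    (hn : (1 <= n)%N) (hK : K = [set i k | k : 'I_n.+1])
    (cardK : #|K| = n.+1) (starK : star K) :
  modJ (gqDelta K)
  = modJ (gqDelta
      [set (if (k.+1 <= n.-1)%N then i k else bar (i k)) | k : 'I_n.+1]).
Proof.
have inj_i : injective i.
  have /imset_injP inj_i : #|[set i k | k : 'I_n.+1]| == #|'I_n.+1|.
    by rewrite -hK cardK card_ord.
  by move=> k l; apply: inj_i.
have ltp : (n.-1 < n.+1)%N by lia.
(* After the shift, [p] and [q] are the positions of $i_n$ and $i_{n+1}$, the only ones where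
   [k.+1 <= n.-1] fails. *)
pose p := Ordinal ltp; pose q : 'I_n.+1 := ord_max.
have iK k : i k \in K by rewrite hK imset_f.
have qp : i q != i p.
  by rewrite (inj_eq inj_i) -val_eqE /=; lia.
have qK' : i q \in flip n K (i p) by rewrite !inE qp iK orbT.
have sK' := star_flip1 n K (i p) starK (iK p).
have cK' : #|flip n K (i p)| = n.+1 by rewrite card_flip.
have -> : [set (if (k.+1 <= n.-1)%N then i k else bar (i k)) | k : 'I_n.+1]
    = flip n (flip n K (i p)) (i q).
  (* One inclusion suffices: the right-hand image is indexed by ['I_n.+1], so it has at most [n.+1]
     elements. *)
  apply/esym/eqP; rewrite eqEcard card_flip // cK'.
  apply/andP; split; last first.
    by apply: leq_trans (leq_imset_card _ _) _; rewrite card_ord.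
  apply/subsetP => x; rewrite !inE => /orP[/eqP->|/andP[xq /orP[/eqP->|/andP[xp]]]].
  - by apply/imsetP; exists q => //; rewrite /= ifF //; lia.
  - by apply/imsetP; exists p => //; rewrite /= ltnn.
  - rewrite hK => /imsetP[k _ xE]; apply/imsetP; exists k => //.
    move: xp xq; rewrite xE !(inj_eq inj_i) -!val_eqE /= => kp kq.
    by rewrite ifT //; have := ltn_ord k; lia.
(* Both sums equal the same power and share the term of [flip n K (i p)], which cancels. *)
have := modJ_Delta_flip n _ _ hn sK' cK' qK'.
rewrite -(modJ_Delta_flip n K (i p) hn starK cardK (iK p)) addrC.
by move/addIr.
Qed.
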